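(* Let $K$ be a field, $X$ an $m\times n$ matrix of indeterminates, and let $I$ and $J$ be ideals of $K[X]$, each having a $K$-basis of standard bitableaux. (a) If $I$ and $J$ are G-KRS, then $I+J$ is also G-KRS. (b) If $I$ and $J$ are in-KRS, then $I+J$ and $I\cap J$ are also in-KRS.
   Context: A minor is $[a_1,\dots,a_t\mid b_1,\dots,b_t]=\det(X_{a_ib_j})_{1\le i,j\le t}$ with $1\le a_1<\dots<a_t\le m$, $1\le b_1<\dots<b_t\le n$; its size is $t$, and the empty minor is $1$. A bitableau is a product $\Delta=\delta_1\cdots\delta_w$ of minors ordered so that $|\delta_1|\ge\dots\ge|\delta_w|$, where $|\delta|$ is the size of $\delta$; it is written $(a_{ij}\mid b_{ij})$, where $a_{i1}<a_{i2}<\cdots$ and $b_{i1}<b_{i2}<\cdots$ are the row and column indices of $\delta_i$ (row $i$ of the left and right tableau). Partial order on minors: $[a_1,\dots,a_t\mid b_1,\dots,b_t]\preceq[c_1,\dots,c_u\mid d_1,\dots,d_u]$ iff $t\ge u$ and $a_i\le c_i$, $b_i\le d_i$ for $i=1,\dots,u$. The bitableau is standard if $\delta_1\preceq\dots\preceq\delta_w$. The standard bitableaux form a $K$-basis of $K[X]$. An ideal has a standard basis if it is the $K$-span of the standard bitableaux contained in it. KRS: for a non-empty standard bitableau $\Sigma=(a_{ij}\mid b_{ij})$ let $\ell$ be the largest entry of the left tableau, and let $(p,q)$ be the position with $a_{pq}=\ell$ having largest row index $p$. Remove the boxes at position $(p,q)$ from both tableaux and put $s=b_{pq}$. While $p>1$: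 in row $p-1$ of the right tableau, replace the rightmost entry that is $\le s$ by $s$, let $s$ be the replaced entry, and replace $p$ by $p-1$. When $p=1$ put $r=s$. The result is a standard bitableau $\Sigma'$ and a pair $(\ell,r)$. Define recursively $\operatorname{KRS}(1)=1$ and $\operatorname{KRS}(\Sigma)=\operatorname{KRS}(\Sigma')X_{\ell r}$. This is a bijection from standard bitableaux to monomials of $K[X]$, and it is extended $K$-linearly to a vector space automorphism $\operatorname{KRS}$ of $K[X]$. Initial ideals are taken with respect to a fixed diagonal term order on $K[X]$, i.e. a term order for which $\operatorname{in}([a_1,\dots,a_t\mid b_1,\dots,b_t])=X_{a_1b_1}\cdots X_{a_tb_t}$ for every minor. An ideal $I$ with a standard basis is in-KRS if $\operatorname{in}(I)=\operatorname{KRS}(I)$, and it is G-KRS if, in addition, the bitableaux $\Delta\in I$ form a Gröbner basis of $I$. *)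

(* Defs.v *)
From HB Require Import structures.
From mathcomp Require Import all_boot all_order all_algebra.
From mathcomp Require Import mpoly.

Set Implicit Arguments.
Unset Strict Implicit.
Unset Printing Implicit Defensive.

Import GRing.Theory.

Local Open Scope ring_scope.

(* Row and column indices are 0-based: 'I_m and 'I_n stand for 1..m, 1..n.    *)

Section Tableaux.

Variables m n : nat.

(* [a_1, .., a_t | b_1, .., b_t] is the list (a_1, b_1), .., (a_t, b_t).      *)
Definition minor : Type := seq ('I_m * 'I_n).

Definition is_minor (d : minor) : bool :=
  sorted ltn [seq val x.1 | x <- d] && sorted ltn [seq val x.2 | x <- d].

(* zip truncates to the shorter list, which is e.                             *)
Definition minor_le (d e : minor) : bool :=
  (size e <= size d)%N
  && all (fun xy : ('I_m * 'I_n) * ('I_m * 'I_n) =>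
            (xy.1.1 <= xy.2.1)%N && (xy.1.2 <= xy.2.2)%N)
         (zip d e).

(* Factors equal to the empty minor are dropped, so that the product 1 is the *)
(* empty list only.                                                           *)
Definition bitableau : Type := seq minor.

Definition is_bitableau (D : bitableau) : bool :=
  all (fun d => is_minor d && (d != [::])) D && sorted geq (map size D).

Definition standard (D : bitableau) : bool :=
  is_bitableau D && sorted minor_le D.

(* The right-hand entry replaced is the rightmost one that is <= s; None if   *)
(* there is no such entry (which does not happen in a standard bitableau).    *)
Fixpoint replace_rightmost (s : 'I_n) (d : minor) : option (minor * 'I_n) :=
  if d is x :: d' then
    if replace_rightmost s d' is Some (e, s') then Some (x :: e, s')
    else if (x.2 <= s)%N then Some ((x.1, s) :: d', x.2) else None
  else None.

(* D holds the rows 1, .., p - 1; they are traversed from the last to the     *)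
(* first, and the second component returned is r.                             *)
Fixpoint push_up (D : bitableau) (s : 'I_n) : bitableau * 'I_n :=
  if D is d :: D' then
    let: (E, s1) := push_up D' s in
    let: (e, s2) := odflt (d, s1) (replace_rightmost s1 d) in
    (e :: E, s2)
  else ([::], s).

Definition krs_step (D : bitableau) : option (bitableau * ('I_m * 'I_n)) :=
  let l : nat := (\max_(d <- D) \max_(x <- d) val x.1)%N in
  let is_l (x : 'I_m * 'I_n) := val x.1 == l in
  let p : nat := (\max_(i < size D | has is_l (nth [::] D i)) i)%N in
  let d := nth [::] D p in
  let q := find is_l d in
  if onth d q is Some (a, s) then
    let: (E, r) := push_up (take p D) s in
    let D' := E ++ (take q d ++ drop q.+1 d) :: drop p.+1 D in
    Some ([seq e <- D' | e != [::]], (a, r))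
  else None.

Fixpoint krs_rec (k : nat) (D : bitableau) : 'X_{1..m * n} :=
  if k is k'.+1 then
    if krs_step D is Some (D', (a, r)) then
      (krs_rec k' D' + U_(mxvec_index a r))%MM
    else 0%MM
  else 0%MM.

(* Each step removes one box, so the number of boxes bounds the recursion.    *)
Definition krs (D : bitableau) : 'X_{1..m * n} := krs_rec (sumn (map size D)) D.

End Tableaux.

Section Ideals.

Variables (K : fieldType) (N : nat).

Local Notation R := {mpoly K[N]}.

(* The unit ideal is allowed, unlike in MathComp's idealr_closed.             *)
Definition is_ideal (I : R -> Prop) : Prop :=
  [/\ I 0,
      forall f g, I f -> I g -> I (f + g)
    & forall f g, I g -> I (f * g)].

Definition ideal_add (I J : R -> Prop) : R -> Prop :=
  fun h => exists f g, [/\ I f, J g & h = f + g].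

Definition ideal_cap (I J : R -> Prop) : R -> Prop := fun h => I h /\ J h.

Definition generated_ideal (S : R -> Prop) : R -> Prop :=
  fun h => forall L, is_ideal L -> (forall f, S f -> L f) -> L h.

Definition term_order (le : rel 'X_{1..N}) : Prop :=
  [/\ total le, antisymmetric le, transitive le,
      forall a, le 0%MM a
    & forall a b c, le a b -> le (a + c)%MM (b + c)%MM].

(* in(f) = 'X_[a]; no such a exists when f = 0.                               *)
Definition initial_monomial (le : rel 'X_{1..N}) (f : R) (a : 'X_{1..N}) :=
  a \in msupp f /\ forall b, b \in msupp f -> le b a.

Definition initial_ideal (le : rel 'X_{1..N}) (S : R -> Prop) : R -> Prop :=
  generated_ideal
    (fun h => exists f a, [/\ S f, initial_monomial le f a & h = 'X_[a]]).

(* G may be infinite.                                                         *)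
Definition groebner_basis (le : rel 'X_{1..N}) (I G : R -> Prop) : Prop :=
  (forall g, G g -> I g)
  /\ (forall h, initial_ideal le G h <-> initial_ideal le I h).

End Ideals.

Section KRS.

Variables (K : fieldType) (m n : nat).

Local Notation R := {mpoly K[m * n]}.

Definition minor_poly (d : minor m n) : R :=
  \det (\matrix_(i < size d, j < size d)
          'X_(mxvec_index (tnth (in_tuple d) i).1 (tnth (in_tuple d) j).2)).

Definition bitableau_poly (D : bitableau m n) : R :=
  \prod_(d <- D) minor_poly d.

Definition diagonal_term_order (le : rel 'X_{1..m * n}) : Prop :=
  term_order le
  /\ forall d : minor m n, is_minor d ->
       initial_monomial le (minor_poly d)
         (\sum_(x <- d) U_(mxvec_index x.1 x.2))%MM.

Definition has_standard_basis (I : R -> Prop) : Prop :=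
  forall f, I f <->
    exists r : seq (K * bitableau m n),
      (forall u, u \in r -> standard u.2 /\ I (bitableau_poly u.2))
      /\ f = \sum_(u <- r) u.1 *: bitableau_poly u.2.

(* The graph of the K-linear extension of D |-> 'X_[krs D] from standard      *)
(* bitableaux to K[X]. It is the graph of a function because the standard     *)
(* bitableaux are a K-basis of K[X].                                          *)
Definition KRS (f g : R) : Prop :=
  exists r : seq (K * bitableau m n),
    [/\ forall u, u \in r -> standard u.2,
        f = \sum_(u <- r) u.1 *: bitableau_poly u.2
      & g = \sum_(u <- r) u.1 *: 'X_[krs u.2]].

Definition KRS_image (I : R -> Prop) : R -> Prop :=
  fun g => exists f, I f /\ KRS f g.

Definition in_KRS (le : rel 'X_{1..m * n}) (I : R -> Prop) : Prop :=
  [/\ is_ideal I, has_standard_basis I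
    & forall g, initial_ideal le I g <-> KRS_image I g].

(* The Groebner basis consists of all bitableaux in I, standard or not.       *)
Definition G_KRS (le : rel 'X_{1..m * n}) (I : R -> Prop) : Prop :=
  in_KRS le I
  /\ groebner_basis le I
       (fun g => I g /\ exists D, is_bitableau D /\ g = bitableau_poly D).

End KRS.

(* Main.v *)
Require Import Defs.
From mathcomp Require Import all_boot all_order all_algebra.
From mathcomp Require Import mpoly.
From mathcomp Require Import zify.
From Stdlib Require Import Classical.

(** Write A and B for the sets of standard bitableaux in I and in J. The proof
    rests on two facts.

    Combinatorics: KRS preserves degrees and is injective on standard
    bitableaux ([mdeg_krs], [krs_inj]). A step of KRS is undone by row
    insertion ([row_insert_krs_step]). The pairs produced by successive steps
    have weakly decreasing row index, and weakly increasing column index as long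
    as the row index stays the same ([krs_step_mono]), so the first pair, and by
    induction the whole process, can be read off the monomial.

    Counting: a span of k polynomials contains at most k distinct initial
    monomials, and if it contains k of them then the polynomials are linearly
    independent ([initial_monomials_count], [free_of_initial_monomials]).

    Since I is in-KRS, KRS(D) is an initial monomial of I for every D in A, and
    similarly for J. Bitableaux are homogeneous, so each degree can be treated
    separately, where only finitely many bitableaux occur. Those of A union B span
    I + J and have as many distinct images under KRS, all initial monomials of
    I + J. Counting shows that these are all the initial monomials of I + J
    ([spanned_initial]), and that A union B is linearly independent
    ([spanned_independent]). The first fact is the claim on in(I + J), and it
    turns Groebner bases of I and J into one of I + J.

    By independence of A union B, the ideal I inter J is spanned by A inter B
    ([spanned_cap]). An initial monomial of I inter J is one of I and of J, hence
    the image of an element of A and of an element of B, which coincide by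
    injectivity of KRS. So the initial monomials of I inter J lie in KRS(A inter B),
    and counting once more shows that all of KRS(A inter B) is attained
    ([independent_attained]).

    Finally, KRS is treated as a relation, and two of its values at the same
    polynomial differ by a value at 0. Such a value lies in KRS(I) = in(I) and in
    KRS(J) = in(J), so its monomials are images of elements of A and of B
    ([in_KRS_criterion]). *)

Set Implicit Arguments.
Unset Strict Implicit.
Unset Printing Implicit Defensive.

Import GRing.Theory.

(** * Minors, bumping, and the upward pass of KRS *)

Section Rows.
Variables m n : nat.
Local Notation box := ('I_m * 'I_n)%type.
Local Notation minor := (minor m n).
Local Notation bitableau := (bitableau m n).
Implicit Types (x y : box) (d e f g pre post : minor) (D U W E : bitableau).
Implicit Types (a b : 'I_m) (r s t : 'I_n).

Definition box_lt x y : bool := (x.1 < y.1)%N && (x.2 < y.2)%N.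

Lemma is_minorE d : is_minor d = pairwise box_lt d.
Proof.
rewrite /is_minor !sorted_pairwise; try exact: ltn_trans.
by rewrite !pairwise_map -pairwise_relI.
Qed.

Lemma is_minor_cat pre post : is_minor (pre ++ post) =
  [&& is_minor pre, is_minor post & allrel box_lt pre post].
Proof. by rewrite !is_minorE pairwise_cat andbC -andbA andbA andbC andbA -andbA. Qed.

Lemma is_minor_rcons d x :
  is_minor (rcons d x) = is_minor d && all (box_lt^~ x) d.
Proof. by rewrite !is_minorE pairwise_rcons andbC. Qed.

Lemma is_minor_cons d x :
  is_minor (x :: d) = is_minor d && all (box_lt x) d.
Proof. by rewrite !is_minorE pairwise_cons andbC. Qed.

Lemma minor_le0 d : minor_le d [::].
Proof. by case: d. Qed.

(** This recursion, with [minor_le0], is what all inductions on rows use. *)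
Lemma minor_le_cons x y d e : minor_le (x :: d) (y :: e) =
  [&& (x.1 <= y.1)%N, (x.2 <= y.2)%N & minor_le d e].
Proof. by rewrite /minor_le /= ltnS andbCA -andbA. Qed.

Lemma minor_le_trans : transitive (@minor_le m n).
Proof.
move=> e d f; elim: d e f => [|x d IH] [|y e] [|z f] //; rewrite ?minor_le0 //.
rewrite !minor_le_cons => /and3P[h1 h2 h3] /and3P[k1 k2 k3].
by rewrite (leq_trans h1 k1) (leq_trans h2 k2) (IH e).
Qed.

Lemma minor_le_size d e : minor_le d e -> (size e <= size d)%N.
Proof. by case/andP. Qed.

Variant replace_spec s d : option (minor * 'I_n) -> Prop :=
| ReplaceNone of all (fun x => (s < x.2)%N) d : replace_spec s d None
| ReplaceSome pre a t post of d = pre ++ (a, t) :: post & (t <= s)%N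
    & all (fun x => (s < x.2)%N) post :
    replace_spec s d (Some (pre ++ (a, s) :: post, t)).

Lemma replaceP s d : replace_spec s d (replace_rightmost s d).
Proof.
elim: d => [|x d IH] /=; first exact: ReplaceNone.
case: IH => [h|pre a t post -> ts h]; last first.
  by rewrite -!cat_cons; apply: ReplaceSome h.
case: leqP => xs; last by apply: ReplaceNone; rewrite /= xs.
by case: x xs => a t /= ts; apply: (@ReplaceSome s _ [::] a t d).
Qed.

Lemma replace_minor s d e t :
  is_minor d -> replace_rightmost s d = Some (e, t) -> is_minor e.
Proof.
case: replaceP => // pre a t' post -> ts hpost.
move=> dm [<- _]; move: dm.
rewrite !is_minor_cat !is_minor_cons => /and3P[h1 /andP[h2 h3] h4].
rewrite h1 h2 /=; apply/andP; split.
  apply/allP=> x xp; move/allP/(_ _ xp): hpost; move/allP/(_ _ xp): h3.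
  by rewrite /box_lt /= => /andP[-> _] ->.
move: h4; rewrite !allrel_consr => /andP[h4 ->]; rewrite andbT.
apply: sub_all h4 => x; rewrite /box_lt /= => /andP[-> /leq_trans]; exact.
Qed.

(** The situation in which the upward pass of KRS continues: [s] is being moved
    out of the row [f], which thereby becomes [f'], and any row [d] that could
    stand above [f] both accepts [s] and still fits above [f'] afterwards. *)
Definition pushable f s f' : Prop :=
  forall d, is_minor d -> minor_le d f ->
    exists e t, replace_rightmost s d = Some (e, t) /\ minor_le e f'.

(** Columns weakly increase, so above an entry that is at most [s] there is
    another one: the upward pass always finds an entry to replace. *)
Lemma replace_some_of_le d f s x :
  minor_le d f -> x \in f -> (x.2 <= s)%N -> replace_rightmost s d <> None.
Proof.
move=> df xf xs; case: replaceP => // /allP h _.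
have [y yd yx] : exists2 y, y \in d & (y.2 <= x.2)%N.
  elim: f d df xf {h} => [|z f IH] [|w d] //; rewrite minor_le_cons => /and3P[_ h2 h3].
  rewrite inE => /orP[/eqP->|xf]; first by exists w; rewrite ?mem_head.
  by have [y yd yx] := IH _ h3 xf; exists y; rewrite // inE yd orbT.
by have := h _ yd; rewrite ltnNge (leq_trans yx xs).
Qed.

(** The new entry [s] fits in any column over [f]. This serves for the part of a
    row to the right of the entry [s] that is moved out of it. *)
Lemma minor_le_replace s d e t f : 
  minor_le d f -> all (fun x => (s <= x.2)%N) f ->
  replace_rightmost s d = Some (e, t) -> minor_le e f.
Proof.
elim: d e t f => [|x d IH] e t [|y f] //=; first by rewrite !minor_le0.
rewrite minor_le_cons => /and3P[h1 h2 h3] /andP[k1 k2].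
case E: replace_rightmost => [[e' t']|].
  by case=> <- _; rewrite minor_le_cons h1 h2 (IH _ _ _ h3 k2 E).
by case: ifP => // _ [<- _]; rewrite minor_le_cons h1 k1.
Qed.

(** Above an entry [t], the rightmost entry that is at most [t] is in the same
    column or further to the right. In the same column, the new entry [t] stands
    above the entry [s] that has replaced [t]; further to the right, it stands
    above an entry of [post]. *)
Lemma pushable_replace pre a t post s : is_minor (pre ++ (a, t) :: post) ->
  (t <= s)%N -> pushable (pre ++ (a, t) :: post) t (pre ++ (a, s) :: post).
Proof.
move=> fm ts d _ df.
have dn : replace_rightmost t d <> None.
  by apply: (replace_some_of_le df (x := (a, t))); rewrite // mem_cat mem_head orbT.
case E: replace_rightmost dn => [[e u]|] // _; exists e, u; split=> //.
elim: pre d e u fm df E => [|y pre IH] [|x d] e u //=.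
  rewrite is_minor_cons => /andP[_ hpost]; rewrite minor_le_cons /= => /and3P[h1 h2 h3].
  case E: replace_rightmost => [[e' t']|].
    case=> <- _; rewrite minor_le_cons /= h1 (leq_trans h2 ts) /=.
    apply: minor_le_replace E => //; apply: sub_all hpost => z.
    by rewrite /box_lt /= => /andP[_ /ltnW].
  by rewrite h2 => -[<- _]; rewrite minor_le_cons /= h1 ts.
rewrite is_minor_cons => /andP[fm _]; rewrite minor_le_cons => /and3P[h1 h2 h3].
have dn : replace_rightmost t d <> None.
  by apply: (replace_some_of_le h3 (x := (a, t))); rewrite // mem_cat mem_head orbT.
case E: replace_rightmost dn => [[e' t']|] // _ [<- _].
by rewrite minor_le_cons h1 h2 (IH _ _ _ fm h3 E).
Qed.

(** The first move starts from the end of a row, so the entry replaced above is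
    at least as far to the right and has nothing below it any more. *)
Lemma pushable_remove d a s : pushable (rcons d (a, s)) s d.
Proof.
move=> g _ df.
have dn : replace_rightmost s g <> None.
  by apply: (replace_some_of_le df (x := (a, s))); rewrite // mem_rcons mem_head.
case E: replace_rightmost dn => [[e u]|] // _; exists e, u; split=> //.
elim: d g e u df E => [|y d IH] [|x g] e u //=; rewrite ?minor_le0 //.
rewrite minor_le_cons => /and3P[h1 h2 h3].
have dn : replace_rightmost s g <> None.
  by apply: (replace_some_of_le h3 (x := (a, s))); rewrite // mem_rcons mem_head.
case E: replace_rightmost dn => [[e' t']|] // _ [<- _].
by rewrite minor_le_cons h1 h2 (IH _ _ _ h3 E).
Qed.

(** The graph of [push_up] along runs in which every row accepts the entry, with
    the position of each replacement made explicit. *)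
Inductive pushes : bitableau -> 'I_n -> bitableau -> 'I_n -> Prop :=
| PushesNil s : pushes [::] s [::] s
| PushesCons U s E s1 pre a t post : pushes U s E s1 -> (t <= s1)%N ->
    all (fun x => (s1 < x.2)%N) post ->
    is_minor (pre ++ (a, t) :: post) -> is_minor (pre ++ (a, s1) :: post) ->
    pushes ((pre ++ (a, t) :: post) :: U) s ((pre ++ (a, s1) :: post) :: E) t.

Lemma push_upP U f s f' W : 
  all (@is_minor m n) U -> sorted (@minor_le m n) (U ++ f :: W) ->
  pushable f s f' ->
  [/\ pushes U s (push_up U s).1 (push_up U s).2,
     sorted (@minor_le m n) (rcons (push_up U s).1 f') &
     pushable (head f U) (push_up U s).2 (head f' (push_up U s).1)].
Proof.
move=> Um US fs.
elim: U Um US => [|d U IH] /=; first by split=> //; constructor.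
case/andP=> dm Um dUS.
have {IH} := IH Um (path_sorted dUS).
case: push_up => E s1 /= [p1 p2 p3].
have dle : minor_le d (head f U) by case: (U) dUS => [|u U'] /= /andP[].
have [e [t [er le]]] := p3 d dm dle; rewrite er /=.
have em := replace_minor dm er.
split.
- case: replaceP er dm em => // pre a t' post -> ts hpost [<- <-] h1 h2.
  by constructor.
- by case: (E) le p2 => [|e1 E1] /= -> .
- case: replaceP er dm em => // pre a t' post -> ts hpost [<- <-] h1 h2.
  exact: pushable_replace.
Qed.

Lemma pushes_minor U s E r : pushes U s E r -> all (@is_minor m n) E.
Proof. by elim=> //= {}U {}s {}E s1 pre a t post _ -> _ _ _ ->. Qed.

Lemma pushes_shape U s E r : pushes U s E r -> map size E = map size U.
Proof. by elim=> //= {}U {}s {}E s1 pre a t post _ -> _ _ _ _; rewrite !size_cat. Qed.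

Lemma pushes_left U s E r :
  pushes U s E r -> map (map fst) E = map (map fst) U.
Proof. by elim=> //= {}U {}s {}E s1 pre a t post _ -> _ _ _ _; rewrite !map_cat. Qed.

(** Cutting the upward pass at a row [f] of the result; [s1] is the entry that
    [f] received and [t] the one that it gave away. *)
Lemma pushes_cat U s E1 f E2 r : pushes U s (E1 ++ f :: E2) r ->
  exists U1 pre a t post s1, [/\ f = pre ++ (a, s1) :: post,
    (t <= s1)%N & pushes U1 t E1 r].
Proof.
elim: E1 U r => [|e E1 IH] U r h;
  inversion h as [|U0 s0 E0 s1 pre a t post k1 k2 k3 k4 k5 e1 e2 e3 e4]; subst.
  exists [::], pre, a, r, post, s1; split=> //; constructor.
have [U1 [pre' [a' [t' [post' [s1' [h1 h2 h3]]]]]]] := IH _ _ k1.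
exists ((pre ++ (a, r) :: post) :: U1), pre', a', t', post', s1'; split=> //.
by constructor.
Qed.

(** Two successive passes, the second one with an entry that is not smaller: the
    second path stays weakly to the right of the first, as the entry that the
    first pass has put into a row is still available to the second. *)
Lemma pushes_mono U E F s t r r' : pushes U s E r -> pushes E t F r' ->
  (s <= t)%N -> (r <= r')%N.
Proof.
move=> h; elim: h t F r' => [s0 t F r' h|]; first by inversion h.
move=> {}U {}s {}E s1 pre a x post h IH xs hpost m1 m2 t F r' h' st.
inversion h' as [|E' t0 F' t1 pre' a' x' post' k1 k2 k3 k4 k5 e1 e2 e3 e4]; subst.
have st1 := IH _ _ _ k1 st.
apply: (leq_trans xs).
have : (a, s1) \in pre' ++ (a', r') :: post' by rewrite e1 mem_cat mem_head orbT.
rewrite mem_cat inE => /or3P[hin|/eqP[_ ->] //|hin].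
  move: k4; rewrite is_minor_cat => /and3P[_ _ /allrelP/(_ _ _ hin (mem_head _ _))].
  by case/andP=> _ /= /ltnW.
by have := allP k3 _ hin; rewrite /= ltnNge st1.
Qed.

(** The leftmost entry that is at least [r] is replaced by [r]. *)
Fixpoint bump_row r d : option (minor * 'I_n) :=
  if d is x :: d' then
    if (r <= x.2)%N then Some ((x.1, r) :: d', x.2)
    else if bump_row r d' is Some (e, s) then Some (x :: e, s) else None
  else None.

(** Row insertion of [x.2]; the box that is created at the end carries [x.1] as
    its left entry. *)
Fixpoint row_insert (x : box) D : bitableau :=
  if D is d :: D' then
    if bump_row x.2 d is Some (e, s) then e :: row_insert (x.1, s) D'
    else rcons d x :: D'
  else [:: [:: x]].

Lemma bump_row_replaced pre a t s post : (t <= s)%N ->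
  is_minor (pre ++ (a, t) :: post) ->
  bump_row t (pre ++ (a, s) :: post) = Some (pre ++ (a, t) :: post, s).
Proof.
move=> ts; elim: pre => [|x pre IH] /=; first by rewrite ts.
rewrite is_minor_cons all_cat /= => /andP[h /and3P[_ /andP[_ /= xt] _]].
by rewrite leqNgt xt /= IH.
Qed.

Lemma bump_row_none d r : all (fun x => (x.2 < r)%N) d -> bump_row r d = None.
Proof. by elim: d => //= x d IH /andP[h /IH ->]; rewrite leqNgt h. Qed.

(** In a row that received an entry in exchange for a smaller or equal one, the new
    entry is the leftmost one that is at least as large as the old one, since all
    entries before it were smaller than the old one. So
    insertion retraces the path downwards, and it ends in the row [d], all of
    whose entries are smaller than [s]. *)
Lemma row_insert_pushes U s E r a d W : pushes U s E r -> 
  is_minor (rcons d (a, s)) ->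
  row_insert (a, r) (E ++ d :: W) = U ++ rcons d (a, s) :: W.
Proof.
elim=> [s0|{}U {}s {}E s1 pre b t post h IH ts hpost m1 m2] dm /=.
  rewrite bump_row_none //; move: dm; rewrite is_minor_rcons => /andP[_].
  by apply: sub_all => x /andP[].
by rewrite bump_row_replaced // IH.
Qed.


(** * One step of KRS and its inverse *)

Definition boxes D : nat := sumn (map size D).

(** Rows that increase for [minor_le] have decreasing sizes. *)
Lemma standardE D : standard D =
  [&& all (@is_minor m n) D, all (fun d => d != [::]) D & sorted (@minor_le m n) D].
Proof.
rewrite /standard /is_bitableau all_predI -!andbA; do 2!congr andb.
rewrite andb_idl // sorted_map; apply: sub_sorted => d e; exact: minor_le_size.
Qed.

(** [rcons d (a, s)] is the last row that contains the largest left entry [a];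
    strictness puts [a] at the end of the row. *)
Lemma last_row D : all (@is_minor m n) D -> all (fun d => d != [::]) D ->
  D != [::] -> exists U d a s W, [/\ D = U ++ rcons d (a, s) :: W,
     all (all (fun x => x.1 <= a)%N) U & all (all (fun x => x.1 < a)%N) W].
Proof.
elim: D => [|g D IH] //= /andP[gm Dm] /andP[g0 D0] _.
have {g0} [d [b [t ge]]] : exists d b t, g = rcons d (b, t).
  by case/lastP: g gm g0 => // d [b t] _ _; exists d, b, t.
have [D1|Dn] := eqVneq D [::].
  by exists [::], d, b, t, [::]; rewrite D1 ge.
have [U [d' [a [s [W [De Ua Wa]]]]]] := IH Dm D0 Dn.
have gb x : x \in g -> (x.1 <= b)%N.
  move: gm; rewrite ge is_minor_rcons mem_rcons inE => /andP[_ /allP h].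
  by case/orP=> [/eqP->//|/h /andP[/ltnW]].
have [ba|ab] := leqP b a.
  exists (g :: U), d', a, s, W; rewrite De; split=> //=; rewrite Ua andbT.
  by apply/allP=> x /gb /leq_trans; apply.
exists [::], d, b, t, D; rewrite ge; split=> //.
have lt : {in D, forall e, all (fun x => x.1 <= a)%N e}.
  move=> e; rewrite De mem_cat inE => /or3P[/(allP Ua)//|/eqP->|/(allP Wa)].
    have: is_minor (rcons d' (a, s)).
      by apply: (allP Dm); rewrite De mem_cat mem_head orbT.
    rewrite is_minor_rcons all_rcons leqnn => /andP[_]; apply: sub_all => x.
    by case/andP=> /ltnW.
  by apply: sub_all => x /ltnW.
by apply/allP=> e /lt; apply: sub_all => x xa; apply: leq_ltn_trans ab.
Qed.

(** The position found by [krs_step] is the last box of the middle row. *)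
Lemma krs_stepE U d a s W : is_minor (rcons d (a, s)) ->
    all (all (fun x => x.1 <= a)%N) U -> all (all (fun x => x.1 < a)%N) W ->
  krs_step (U ++ rcons d (a, s) :: W) =
  Some ([seq e <- (push_up U s).1 ++ d :: W | e != [::]], (a, (push_up U s).2)).
Proof.
rewrite is_minor_rcons => /andP[_ da] Ua Wa; rewrite /krs_step.
set D := U ++ _.
have da' : all (fun x => x.1 < a)%N d by apply: sub_all da => x /andP[].
have lE : (\max_(d <- D) \max_(x <- d) val x.1)%N = a.
  apply/eqP; rewrite eqn_leq; apply/andP; split.
    apply/bigmax_leqP_seq => e; rewrite mem_cat inE => eD _.
    apply/bigmax_leqP_seq => x xe _; case/or3P: eD => [|/eqP ee|] /=.
    - by move/(allP Ua)/allP; apply.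
    - move: xe; rewrite ee mem_rcons inE => /orP[/eqP->//|/(allP da')].
      exact: ltnW.
    - by move/(allP Wa)/allP/(_ _ xe)/ltnW.
  have h : rcons d (a, s) \in D by rewrite mem_cat mem_head orbT.
  apply: leq_trans (leq_bigmax_seq _ h isT).
  by apply: (@leq_bigmax_seq _ (rcons d (a, s)) xpredT (fun x : box => val x.1) (a, s));
    rewrite // mem_rcons mem_head.
rewrite lE; set is_l := (fun x : box => val x.1 == a).
have nthD : nth [::] D (size U) = rcons d (a, s).
  by rewrite nth_cat ltnn subnn.
have pE : (\max_(i < size D | has is_l (nth [::] D i)) i)%N = size U.
  apply/eqP; rewrite eqn_leq; apply/andP; split.
    apply/bigmax_leqP => -[i /= iD] hi; rewrite leqNgt; apply/negP => iU.
    have wW : nth [::] D i \in W.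
      rewrite nth_cat ltnNge (ltnW iU) /= -(subnSK iU) /= mem_nth //.
      by rewrite ltn_subLR //; move: iD; rewrite size_cat /= addnS addSn.
    case/hasP: hi => x xi /eqP xa; have := allP (allP Wa _ wW) _ xi.
    by rewrite /= -xa ltnn.
  have h : (size U < size D)%N by rewrite size_cat /=; lia.
  by apply: (leq_bigmax_cond (Ordinal h)); rewrite /= nthD has_rcons /is_l eqxx.
rewrite pE nthD.
have qE : find is_l (rcons d (a, s)) = size d.
  rewrite -cats1 find_cat ifF /= ?/is_l ?eqxx ?addn0 //.
  apply/negbTE/hasPn => x xd; have := allP da' _ xd.
  by rewrite /is_l /= ltn_neqAle => /andP[].
rewrite qE.
have -> : onth (rcons d (a, s)) (size d) = Some (a, s).
  by rewrite -cats1 onth_cat ltnn subnn.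
rewrite take_size_cat // -cats1 take_size_cat // drop_oversize ?cats0; last first.
  by rewrite size_cat addn1.
rewrite drop_cat ltnNge leqnSn /= subSnn /= drop0.
by case: push_up.
Qed.

(** The removed box is a corner: a box below it would contain [a] again. *)
Lemma minor_le_removed d a s e : minor_le (rcons d (a, s)) e ->
  all (fun x => x.1 < a)%N e -> minor_le d e.
Proof.
elim: d e => [|x d IH] [|y e]; rewrite ?minor_le0 //.
  by rewrite minor_le_cons /= ltnNge => /andP[->].
by rewrite rcons_cons !minor_le_cons /= => /and3P[-> -> /IH h] /andP[_ /h].
Qed.

Lemma krs_step_nil : krs_step ([::] : bitableau) = None.
Proof. by rewrite /krs_step /= big_nil big_ord0. Qed.

Variant step_spec D : Prop :=
  StepSpec U d a s W E r of D = U ++ rcons d (a, s) :: W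
    & is_minor (rcons d (a, s)) & path (@minor_le m n) d W
    & all (all (fun x => x.1 <= a)%N) U & all (all (fun x => x.1 < a)%N) W
    & pushes U s E r
    & krs_step D = Some ([seq e <- E ++ d :: W | e != [::]], (a, r))
    & standard [seq e <- E ++ d :: W | e != [::]].

Lemma krs_stepP D : standard D -> D != [::] -> step_spec D.
Proof.
rewrite standardE => /and3P[Dm D0 Ds] Dn.
have [U [d [a [s [W [De Ua Wa]]]]]] := last_row Dm D0 Dn.
have dm : is_minor (rcons d (a, s)).
  by apply: (allP Dm); rewrite De mem_cat mem_head orbT.
have Um : all (@is_minor m n) U by move: Dm; rewrite De all_cat => /andP[].
have Wm : all (@is_minor m n) W.
  by move: Dm; rewrite De all_cat /= => /and3P[].
have dW : path (@minor_le m n) d W.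
  move: Ds; rewrite De sorted_cat_cons => /andP[_].
  case: (W) Wa => //= w W1 /andP[wa _] /andP[h ->]; rewrite andbT.
  exact: minor_le_removed h wa.
have Ds' := Ds; rewrite De in Ds'.
have [p1 p2 _] := push_upP Um Ds' (@pushable_remove d a s).
apply: (@StepSpec D U d a s W (push_up U s).1 (push_up U s).2) => //.
  by rewrite De krs_stepE.
rewrite standardE !all_filter; apply/and3P; split.
- apply/allP => e he; apply/implyP => _; move: he.
  rewrite mem_cat inE => /or3P[/(allP (pushes_minor p1))//|/eqP->|/(allP Wm)//].
  by move: dm; rewrite is_minor_rcons => /andP[].
- by apply/allP=> e _ /=; rewrite implybb.
- apply: sorted_filter; first exact: minor_le_trans.
  by rewrite sorted_cat_cons p2.
Qed.

Lemma boxes_cat D1 D2 : boxes (D1 ++ D2) = (boxes D1 + boxes D2)%N.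
Proof. by rewrite /boxes map_cat sumn_cat. Qed.

Lemma boxes_filter D : boxes [seq d <- D | d != [::]] = boxes D.
Proof. by elim: D => //= -[|x d] D IH //=; rewrite /boxes /= -/(boxes _) IH. Qed.

(** The number of boxes serves as fuel in [krs], and it drops by exactly one. *)
Lemma krs_step_boxes D D' a r : standard D -> krs_step D = Some (D', (a, r)) ->
  [/\ standard D', boxes D = (boxes D').+1 & krs D = (krs D' + U_(mxvec_index a r))%MM].
Proof.
move=> Dst; have [->|Dn] := eqVneq D [::]; first by rewrite krs_step_nil.
case: (krs_stepP Dst Dn) => U d a' s W E r' De dm _ _ _ p stepE Dst' stepE'.
have bD : boxes D = (boxes D').+1.
  move: stepE'; rewrite stepE => -[<- _ _]; rewrite boxes_filter De.
  rewrite !boxes_cat /boxes (pushes_shape p) /= size_rcons; lia.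
have [h1 h2 h3] : [/\ [seq e <- E ++ d :: W | e != [::]] = D', a' = a & r' = r].
  by move: stepE'; rewrite stepE => -[].
rewrite -h1; split=> //; first by rewrite h1.
by rewrite h1 /krs -/(boxes D) bD /= stepE'.
Qed.

Lemma krs0 : krs ([::] : bitableau) = 0%MM.
Proof. by []. Qed.

Lemma boxes_eq0 D : standard D -> boxes D = 0%N -> D = [::].
Proof. by rewrite standardE => /and3P[_]; case: D => // -[|x d] D. Qed.

Lemma krs_step_some D : standard D -> D != [::] ->
  exists D' a r, krs_step D = Some (D', (a, r)).
Proof.
move=> h1 h2; case: (krs_stepP h1 h2) => U d a s W E r _ _ _ _ _ _ h _.
by eexists; exists a, r; exact: h.
Qed.

Lemma mdeg_krs D : standard D -> mdeg (krs D) = boxes D.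
Proof.
move: {2}(boxes D) (erefl (boxes D)) => k; elim: k D => [|k IH] D Dk Dst.
  by rewrite (boxes_eq0 Dst Dk) krs0 mdeg0.
have Dn : D != [::] by apply: contraPneq Dk => ->.
have [D' [a [r st]]] := krs_step_some Dst Dn.
have [Dst' bD ->] := krs_step_boxes Dst st.
by rewrite mdegD mdeg1 IH ?bD ?addn1 //; move: bD; rewrite Dk => -[].
Qed.

(** The variant of [row_insert_pushes] for a box that was alone in its row: the
    emptied row is absent from the result of a step, and insertion restores it. *)
Lemma row_insert_pushes_new_row U s E r a : pushes U s E r ->
  row_insert (a, r) E = U ++ [:: [:: (a, s)]].
Proof.
elim=> [//|{}U {}s {}E s1 pre b t post h IH ts _ m1 _] /=.
by rewrite bump_row_replaced // IH.
Qed.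

Lemma pushes_nonempty U s E r : pushes U s E r ->
  all (fun d => d != [::]) U -> all (fun d => d != [::]) E.
Proof.
move=> p; have h F : all (fun d : minor => d != [::]) F =
    all (fun k => k != 0%N) (map size F).
  by rewrite all_map; apply: eq_all => -[].
by rewrite h -(pushes_shape p) -h.
Qed.

Lemma pushes_bound U s E r a : pushes U s E r ->
  all (all (fun x => x.1 <= a)%N) U -> all (all (fun x => x.1 <= a)%N) E.
Proof.
move=> p; have h F : all (all (fun x : box => x.1 <= a)%N) F =
    all (all (fun b : 'I_m => b <= a)%N) (map (map fst) F).
  by rewrite all_map; apply: eq_all => d; rewrite /= all_map.
by rewrite h -(pushes_left p) -h.
Qed.

Lemma row_insert_krs_step D D' a r : standard D -> krs_step D = Some (D', (a, r)) ->
  row_insert (a, r) D' = D.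
Proof.
move=> Dst; have [->|Dn] := eqVneq D [::]; first by rewrite krs_step_nil.
case: (krs_stepP Dst Dn) => U d a' s W E r' De dm dW _ _ p -> _ [<- <- <-].
rewrite {}De in Dst *.
have [D0 Un Wn] : [/\ all (fun d => d != [::]) (U ++ rcons d (a', s) :: W),
   all (fun d => d != [::]) U & all (fun d => d != [::]) W].
  move: Dst; rewrite standardE => /and3P[_ h _]; split=> //; move: h;
  by rewrite all_cat => /and3P[].
have En := pushes_nonempty p Un.
rewrite filter_cat (all_filterP En) /=; case: eqP => [d0|_]; last first.
  by rewrite /= (all_filterP Wn) (row_insert_pushes _ p dm).
suff -> : W = [::] by rewrite d0 cats0 (row_insert_pushes_new_row _ p).
by move: dW Wn; rewrite d0; case: (W) => //= -[].
Qed.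

Lemma cat_prefix (T : eqType) (s1 s2 s3 s4 : seq T) u :
  s1 ++ u :: s2 = s3 ++ s4 -> u \notin s4 -> exists s5 : seq T, s3 = s1 ++ u :: s5.
Proof.
elim: s1 s3 => [|v s1 IH] [|w s3] /=.
- by move<-; rewrite mem_head.
- by case=> <- _ _; exists s3.
- by move<-; rewrite inE mem_cat mem_head !orbT.
- by case=> <- h xs; have [s5 ->] := IH _ h xs; exists s5.
Qed.

(** If two successive steps remove the same left entry, then the second one starts
    in a higher row, because the first one took the lowest occurrence and a row
    contains [a] only once. It moves the last entry of that row, which is at least the entry that the first pass left in that row, and from there
    [pushes_mono] applies. *)
Lemma krs_step_mono D D1 D2 a r b t : standard D ->
  krs_step D = Some (D1, (a, r)) -> krs_step D1 = Some (D2, (b, t)) ->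
  (b < a)%N \/ b = a /\ (r <= t)%N.
Proof.
move=> Dst; have [->|Dn] := eqVneq D [::]; first by rewrite krs_step_nil.
case: (krs_stepP Dst Dn) => U d a' s W E r' De dm _ Ua Wa p -> Dst1 [De1 <- <-].
rewrite De1 in Dst1; have [D10|D1n] := eqVneq D1 [::]; first by rewrite D10 krs_step_nil.
move=> st1; case: (krs_stepP Dst1 D1n) st1.
move=> U1 d1 b' s1 W1 E1 t' DE dm1 _ _ _ p1 -> _ [_ <- <-].
rewrite {}DE in De1 => {D1 Dst1 D1n}.
have Un : all (fun d => d != [::]) U.
  by move: Dst; rewrite standardE De => /and3P[_]; rewrite all_cat => /andP[].
have Ea := pushes_bound p Ua.
have dWa : all (all (fun x => x.1 < a')%N) (d :: W).
  rewrite /= Wa andbT; move: dm; rewrite is_minor_rcons => /andP[_].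
  by apply: sub_all => x /andP[].
have x1 : (b', s1) \in rcons d1 (b', s1) by rewrite mem_rcons mem_head.
have ba : (b' <= a')%N.
  have: rcons d1 (b', s1) \in [seq e <- E ++ d :: W | e != [::]].
    by rewrite De1 mem_cat mem_head orbT.
  rewrite mem_filter mem_cat => /andP[_ /orP[/(allP Ea)|/(allP dWa)]] /allP/(_ _ x1) //.
  exact: ltnW.
move: ba; rewrite leq_eqVlt => /orP[/eqP/val_inj ba|]; last by left.
right; split=> //; rewrite {}ba in De1 x1 dm1 *.
(* The rows from the first starting row on have lost all their entries a'. *)
move: De1; rewrite filter_cat (all_filterP (pushes_nonempty p Un)) => /esym De1.
have [|E2 Ee] := cat_prefix De1.
  rewrite mem_filter; apply/negP => /andP[_ /(allP dWa)/allP/(_ _ x1)].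
  by rewrite /= ltnn.
rewrite {}Ee in p; have [U' [pre [c [t2 [post [s2 [Re ts pU]]]]]]] := pushes_cat p.
apply: pushes_mono pU p1 _; apply: (leq_trans ts).
have: (c, s2) \in rcons d1 (a', s1) by rewrite Re mem_cat mem_head orbT.
move: dm1; rewrite is_minor_rcons mem_rcons inE => /andP[_ /allP h].
by case/orP=> [/eqP[_ ->]//|/h /andP[_ /ltnW]].
Qed.

(** * Injectivity of KRS *)

Lemma mxvec_index_inj a r b t :
  mxvec_index a r = mxvec_index b t -> a = b /\ r = t.
Proof. by move/cast_ord_inj/enum_rank_inj => [-> ->]. Qed.

(** The pair produced by the first step is extremal among the variables of the
    monomial, for the order that prefers large row and then small column
    indices. Being one of these variables, it is determined by the monomial. *)
Lemma krs_support_bound D D' a r : standard D -> krs_step D = Some (D', (a, r)) ->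
  forall b t, krs D (mxvec_index b t) != 0%N -> (b < a)%N \/ b = a /\ (r <= t)%N.
Proof.
move: {2}(boxes D) (erefl (boxes D)) => k.
elim: k D D' a r => [|k IH] D D' a r Dk Dst st b t.
  by rewrite (boxes_eq0 Dst Dk) krs0 mnm0E.
have [Dst' bD ->] := krs_step_boxes Dst st.
rewrite mnmDE mnm1E addn_eq0 negb_and orbC eqb0 negbK.
case/orP=> [/eqP/mxvec_index_inj[<- <-]|].
  by right.
have [->|Dn'] := eqVneq D' [::]; first by rewrite krs0 mnm0E.
have [D2 [a1 [r1 st1]]] := krs_step_some Dst' Dn'.
have bD' : boxes D' = k by move: bD; rewrite Dk => -[].
move/(IH _ _ _ _ bD' Dst' st1).
case: (krs_step_mono Dst st st1) => [h1|[-> h1]] [h2|[-> h2]].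
- by left; apply: ltn_trans h2 h1.
- by left.
- by left.
- by right; split=> //; apply: leq_trans h1 h2.
Qed.

Lemma krs_inj D1 D2 : standard D1 -> standard D2 -> krs D1 = krs D2 -> D1 = D2.
Proof.
move: {2}(boxes D1) (erefl (boxes D1)) => k.
elim: k D1 D2 => [|k IH] D1 D2 k1 st1 st2 eqk.
all: have k2 : boxes D2 = boxes D1 by rewrite -!mdeg_krs ?eqk.
  by rewrite (boxes_eq0 st1 k1) (boxes_eq0 st2) // k2.
have D1n : D1 != [::] by apply: contraPneq k1 => ->.
have D2n : D2 != [::] by apply: contraPneq k2 => ->; rewrite k1.
have [D1' [a1 [r1 s1]]] := krs_step_some st1 D1n.
have [D2' [a2 [r2 s2]]] := krs_step_some st2 D2n.
have [st1' bD1 e1] := krs_step_boxes st1 s1.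
have [st2' bD2 e2] := krs_step_boxes st2 s2.
have h12 : (a1 < a2)%N \/ a1 = a2 /\ (r2 <= r1)%N.
  by apply: (krs_support_bound st2 s2); rewrite -eqk e1 mnmDE mnm1E eqxx addn1.
have h21 : (a2 < a1)%N \/ a2 = a1 /\ (r1 <= r2)%N.
  by apply: (krs_support_bound st1 s1); rewrite eqk e2 mnmDE mnm1E eqxx addn1.
have [ae re] : a1 = a2 /\ r1 = r2.
  case: h12 h21 => [h|[-> h]] [h'|[h0 h']].
  - by have := ltn_trans h h'; rewrite ltnn.
  - by move: h; rewrite h0 ltnn.
  - by move: h'; rewrite ltnn.
  - by split=> //; apply/val_inj/eqP; rewrite eqn_leq h h'.
rewrite -(row_insert_krs_step st1 s1) -(row_insert_krs_step st2 s2) ae re.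
congr row_insert; apply: IH => //; first by move: bD1; rewrite k1 => -[].
by move: eqk; rewrite e1 e2 ae re => /addIm.
Qed.

End Rows.

(** * Initial monomials of a finite span *)

Local Open Scope ring_scope.

Section Linear.

Lemma list_maximum (T : eqType) (le : rel T) (s : seq T) :
  total le -> transitive le -> s != [::] ->
  exists2 a, a \in s & forall b, b \in s -> le b a.
Proof.
move=> le_total le_trans; have le_refl x : le x x by case/orP: (le_total x x).
elim: s => [//|x s IH _]; have [->|sn] := eqVneq s [::].
  by exists x; rewrite ?mem_head // => b; rewrite inE => /eqP->.
have [a as_ ha] := IH sn; case/orP: (le_total x a) => xa.
  by exists a; rewrite ?inE ?as_ ?orbT // => b /predU1P[->|/ha].
exists x; rewrite ?mem_head // => b /predU1P[->//|/ha ba].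
exact: le_trans ba xa.
Qed.

Lemma list_choice (A : eqType) (B : Type) (b0 : B) (Q : A -> B -> Prop) (s : seq A) :
  (forall a, a \in s -> exists b, Q a b) ->
  exists F : A -> B, forall a, a \in s -> Q a (F a).
Proof.
elim: s => [|x s IH] hs; first by exists (fun=> b0).
have [|F hF] := IH; first by move=> a as_; apply: hs; rewrite inE as_ orbT.
have [b Qb] := hs x (mem_head x s).
exists (fun a => if a == x then b else F a) => a.
by case: eqVneq => [-> //|ax]; rewrite inE (negbTE ax); apply: hF.
Qed.

(** A matrix with more rows than columns has a non-trivial row kernel. *)
Lemma linear_relation (K : fieldType) (A B : eqType) (s : seq A) (t : seq B)
    (M : A -> B -> K) : uniq s -> (size t < size s)%N ->
  exists u : A -> K, (exists2 x, x \in s & u x != 0) /\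
    (forall y, y \in t -> \sum_(x <- s) u x * M x y = 0).
Proof.
move=> us ts.
pose Mx := \matrix_(i < size s, j < size t)
  M (tnth (in_tuple s) i) (tnth (in_tuple t) j).
have /rowV0Pn[v /sub_kermxP vM vn0] : kermx Mx != 0.
  rewrite kermx_eq0 -row_leq_rank -ltnNge; apply: leq_ltn_trans ts.
  exact: rank_leq_col.
(* 0 is a default value for labels outside s. *)
pose u x : K := if insub (index x s) is Some i then v 0 i else 0.
have uE i : u (tnth (in_tuple s) i) = v 0 i.
  rewrite /u (tnth_nth (tnth (in_tuple s) i)) /= index_uniq //.
  by rewrite insubT //= => h; congr (v 0 _); apply: val_inj.
exists u; split.
  have [i vi] : exists i, v 0 i != 0.
    apply/existsP; apply: contraNT vn0; rewrite negb_exists => /forallP h.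
    by apply/eqP/rowP => i; rewrite mxE; apply/eqP; move: (h i); rewrite negbK.
  by exists (tnth (in_tuple s) i); rewrite ?uE ?mem_tnth.
move=> y yt; have [j ->] := tnthP (in_tuple t) y yt.
have := congr1 (fun A : 'M_(_, _) => A 0 j) vM; rewrite !mxE => vj.
rewrite big_tnth -[RHS]vj; apply: eq_bigr => i _.
by rewrite mxE uE.
Qed.

End Linear.

Section Leading.
Variables (K : fieldType) (N : nat) (le : rel 'X_{1..N}).
Hypothesis le_order : term_order le.
Local Notation R := {mpoly K[N]}.
Local Notation lm := (initial_monomial le).
Implicit Types (f g h : R) (a b : 'X_{1..N}).

Lemma initial_monomial_exists f : f != 0 -> exists a, lm f a.
Proof.
case: le_order => le_total _ le_trans _ _; rewrite -msupp_eq0.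
by case/(list_maximum le_total le_trans) => a h1 h2; exists a.
Qed.

(** Among the labels with a non-zero coefficient, the largest one occurs in no
    other summand, so its coefficient in the sum does not vanish. *)
Lemma initial_monomials_free (s : seq 'X_{1..N}) (v : 'X_{1..N} -> R) u :
  uniq s -> (forall a, a \in s -> lm (v a) a) ->
  \sum_(a <- s) u a *: v a = 0 -> forall a, a \in s -> u a = 0.
Proof.
case: le_order => le_total le_anti le_trans _ _ us hv sum0 a as_.
apply/eqP/negPn/negP => ua.
have sn : [seq a <- s | u a != 0] != [::].
  by apply/eqP => /(congr1 (fun s => a \in s)); rewrite mem_filter ua as_.
have [b] := list_maximum le_total le_trans sn.
rewrite mem_filter => /andP[ub bs] bmax.
have /eqP := congr1 (mcoeff b) sum0; rewrite mcoeff0 raddf_sum /= (bigD1_seq b) //=.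
rewrite big_seq_cond big1 ?addr0 => [|c /andP[cs cb]].
  rewrite mcoeffZ mulf_eq0 (negbTE ub) /= -[_ == 0]negbK -mcoeff_msupp.
  by case: (hv b bs) => ->.
rewrite mcoeffZ; have [->|uc] := eqVneq (u c) 0; first by rewrite mul0r.
have [/eqP->|] := boolP ((v c)@_b == 0); first by rewrite mulr0.
rewrite -mcoeff_msupp => /(proj2 (hv c cs)) bc.
by case/eqP: cb; apply: le_anti; rewrite bc bmax // mem_filter uc.
Qed.

Section Family.
Variables (T : eqType) (p : T -> R).

(** Otherwise the coefficient vectors of polynomials with these initial monomials
    would be linearly dependent, and with them the polynomials. *)
Lemma initial_monomials_count (L : seq T) (s : seq 'X_{1..N}) : uniq s ->
  (forall a, a \in s -> exists c : T -> K, lm (\sum_(D <- L) c D *: p D) a) ->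
  (size s <= size L)%N.
Proof.
move=> us hs.
have [C hC] : exists C : 'X_{1..N} -> T -> K,
    forall a, a \in s -> lm (\sum_(D <- L) C a D *: p D) a.
  exact: (list_choice (fun=> 0) hs).
rewrite leqNgt; apply/negP => /(linear_relation C us)[u [[a as_ ua] hu]].
case/eqP: ua; apply: (initial_monomials_free us hC) as_.
under eq_bigr do rewrite scaler_sumr; rewrite exchange_big big_seq big1 // => D DL.
by under eq_bigr do rewrite scalerA; rewrite -scaler_suml hu ?scale0r.
Qed.

(** A dependent family could be shortened without changing its span, which would
    contradict [initial_monomials_count]. *)
Lemma free_of_initial_monomials (L : seq T) (s : seq 'X_{1..N}) (c : T -> K) :
  uniq L -> uniq s -> (size L <= size s)%N ->
  (forall a, a \in s -> exists c : T -> K, lm (\sum_(D <- L) c D *: p D) a) ->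
  \sum_(D <- L) c D *: p D = 0 -> forall D, D \in L -> c D = 0.
Proof.
move=> uL us sz hs c0 D DL; apply/eqP/negPn/negP => cD.
have : (size s <= size (rem D L))%N.
  apply: initial_monomials_count => // a /hs[b hb].
  exists (fun E => b E - b D / c D * c E); move: hb; congr lm.
  have -> : \sum_(E <- L) b E *: p E =
      \sum_(E <- L) b E *: p E - (b D / c D) *: \sum_(E <- L) c E *: p E.
    by rewrite c0 scaler0 subr0.
  rewrite scaler_sumr -sumrB.
  rewrite (big_rem D) //= scalerA divfK // subrr add0r.
  by apply: eq_bigr => E _; rewrite scalerBl scalerA.
rewrite size_rem //; case: (L) DL sz => //= x L' _ sz sz'.
by have := leq_trans sz sz'; rewrite ltnn.
Qed.

(** If [a] is left out of [s], there are fewer vanishing conditions than free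
    coefficients. So some non-zero element of the span has coefficient 0 at all
    other monomials of [s], and [a] is the only initial monomial left for it. *)
Lemma initial_monomials_attained (L : seq T) (s : seq 'X_{1..N}) :
  uniq L -> (size s <= size L)%N ->
  (forall c : T -> K, \sum_(D <- L) c D *: p D = 0 -> forall D, D \in L -> c D = 0) ->
  (forall (c : T -> K) a, lm (\sum_(D <- L) c D *: p D) a -> a \in s) ->
  forall a, a \in s -> exists c : T -> K, lm (\sum_(D <- L) c D *: p D) a.
Proof.
move=> uL sz Lfree hs a as_.
have sz' : (size (rem a s) < size L)%N.
  by rewrite size_rem //; case: (s) as_ sz.
have [c [[D DL cD] hc]] := linear_relation (fun D b => (p D)@_b) uL sz'.
exists c; set f := \sum_(D <- L) _.
have fn : f != 0 by apply: contraNneq cD => /Lfree ->.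
have [b fb] := initial_monomial_exists fn.
have [<-//|ba] := eqVneq b a.
have /hc : b \in rem a s by rewrite (rem_mem ba) // (hs _ _ fb).
have -> : \sum_(D <- L) c D * (p D)@_b = f@_b.
  by rewrite raddf_sum; apply: eq_bigr => E _; rewrite /= mcoeffZ.
by case: fb => + _ /eqP; rewrite mcoeff_msupp => /negbTE ->.
Qed.

Lemma mcoeff_pihomog d f a :
  (pihomog mdeg d f)@_a = if mdeg a == d then f@_a else 0.
Proof.
rewrite pihomogE raddf_sum /= -big_filter.
have [ad|ad] := boolP (mdeg a == d).
  have [af|af] := boolP (a \in msupp f).
    rewrite (bigD1_seq a) ?mem_filter ?ad ?filter_uniq //= mcoeffZ mcoeffX eqxx mulr1.
    by rewrite big1 ?addr0 // => b /negbTE ba; rewrite mcoeffZ mcoeffX ba mulr0.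
  rewrite (memN_msupp_eq0 af) big_filter big_seq_cond big1 // => b /andP[bf _].
  by rewrite mcoeffZ mcoeffX (negbTE (memPn af _ bf)) mulr0.
rewrite big_filter big1 // => b bd; rewrite mcoeffZ mcoeffX.
by case: eqP => [ba|]; rewrite ?mulr0 //; move: ad; rewrite -ba bd.
Qed.

Lemma initial_monomial_pihomog f a : lm f a -> lm (pihomog mdeg (mdeg a) f) a.
Proof.
case=> fa fmax; split.
  by move: fa; rewrite !mcoeff_msupp mcoeff_pihomog eqxx.
move=> b; rewrite mcoeff_msupp mcoeff_pihomog; case: ifP => [_|]; last by rewrite eqxx.
by rewrite -mcoeff_msupp; apply: fmax.
Qed.

(** * Homogeneous families labelled by monomials *)

(** [S], [p] and [k] stand for standard bitableaux, their polynomials and KRS. *)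
Variables (S : T -> Prop) (k : T -> 'X_{1..N}).
Hypothesis k_inj : forall D E, S D -> S E -> k D = k E -> D = E.
Hypothesis p_homog : forall D, S D -> p D \is (mdeg (k D)).-homog.

Definition spanned (P : T -> Prop) f : Prop :=
  exists r : seq (K * T), (forall u, u \in r -> P u.2) /\
    f = \sum_(u <- r) u.1 *: p u.2.

(** A label may occur several times in [r], so independence has to be expressed by
    the sum of its coefficients. *)
Definition total_coef (r : seq (K * T)) D : K := \sum_(u <- r | u.2 == D) u.1.

Definition independent (P : T -> Prop) : Prop := forall r : seq (K * T),
  (forall u, u \in r -> P u.2) -> \sum_(u <- r) u.1 *: p u.2 = 0 ->
  forall D, total_coef r D = 0.

(** Injectivity of the labelling makes the family finite over finitely many
    monomials; the list is built by a case distinction for each monomial. *)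
Lemma enum_labels (P : T -> Prop) (s : seq 'X_{1..N}) :
  (forall D, P D -> S D) ->
  exists L : seq T, uniq L /\ (forall D, D \in L <-> P D /\ k D \in s).
Proof.
move=> PS; elim: s => [|a s [L [uL hL]]].
  by exists [::]; split=> // D; rewrite !in_nil; split=> // -[].
have [[D [PD kD]]|nD] := classic (exists D, P D /\ k D = a).
  have [DL|DL] := boolP (D \in L).
    exists L; split=> // E; rewrite hL inE; split=> [[PE ->]|[PE]]; rewrite ?orbT //.
    case/predU1P=> [kE|//].
    by have -> : E = D; [apply: k_inj; rewrite ?kD; auto | case/hL: DL].
  exists (D :: L); split=> [|E]; first by rewrite /= DL.
  rewrite !inE; split=> [/predU1P[->|/hL[PE ->]]|[PE]].
  - by rewrite kD eqxx.
  - by rewrite orbT.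
  - case/predU1P=> [kE|ks]; first by rewrite (k_inj (PS _ PE) (PS _ PD)) ?kD ?eqxx.
    by apply/orP; right; apply/hL.
exists L; split=> // E; rewrite hL inE; split=> [[PE ->]|[PE]]; rewrite ?orbT //.
by case/predU1P=> [kE|//]; case: nD; exists E.
Qed.

Lemma enum_degree (P : T -> Prop) d : (forall D, P D -> S D) ->
  exists L : seq T, [/\ uniq L, uniq (map k L) &
    forall D, D \in L <-> P D /\ mdeg (k D) = d].
Proof.
move=> PS.
have [L [uL hL]] := enum_labels
  [seq a <- map val (enum {: 'X_{1..N < d.+1}}) | mdeg a == d] PS.
have memL D : D \in L <-> P D /\ mdeg (k D) = d.
  rewrite hL mem_filter; split=> [[PD /andP[/eqP]]|[PD kD]] //; split=> //.
  rewrite kD eqxx /=; apply/mapP.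
  have h : (mdeg (k D) < d.+1)%N by rewrite kD.
  by exists (BMultinom h); rewrite ?mem_enum.
exists L; split=> //; rewrite map_inj_in_uniq // => D E /memL[PD _] /memL[PE _].
by apply: k_inj; apply: PS.
Qed.

Lemma total_coef_graph (L : seq T) (c : T -> K) D : uniq L -> D \in L ->
  total_coef [seq (c E, E) | E <- L] D = c D.
Proof.
move=> uL DL; rewrite /total_coef big_map -big_filter.
by rewrite [filter _ _](filter_pred1_uniq uL DL) big_seq1.
Qed.

Lemma sum_total_coef (r : seq (K * T)) (L : seq T) : uniq L ->
  \sum_(u <- r | u.2 \in L) u.1 *: p u.2 = \sum_(D <- L) total_coef r D *: p D.
Proof.
move=> uL; under [RHS]eq_bigr do rewrite scaler_suml big_mkcond.
rewrite exchange_big big_mkcond; apply: eq_bigr => u _ /=.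
case: ifP => [uL2|uL2].
  rewrite (bigD1_seq u.2) //= eqxx big1 ?addr0 // => D /negbTE.
  by rewrite eq_sym => ->.
by rewrite big_seq big1 // => D; case: eqP => // <-; rewrite uL2.
Qed.

(** Taking the component of degree [d] of a combination means keeping the members
    of degree [d]; this reduces spans of infinite families to finite ones. *)
Lemma pihomog_sum (P : T -> Prop) (r : seq (K * T)) L d :
    (forall D, P D -> S D) -> uniq L ->
    (forall D, D \in L <-> P D /\ mdeg (k D) = d) ->
    (forall u, u \in r -> P u.2) ->
  pihomog mdeg d (\sum_(u <- r) u.1 *: p u.2) =
  \sum_(D <- L) total_coef r D *: p D.
Proof.
move=> PS uL hL rP; rewrite -sum_total_coef // linear_sum /= [RHS]big_mkcond.
apply: eq_big_seq => u ur /=; rewrite linearZ /=.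
have Pu := rP _ ur; have hu := p_homog (PS _ Pu).
have [/eqP kd|kd] := boolP (mdeg (k u.2) == d).
  by rewrite -kd pihomog_dE // ifT //; apply/hL.
by rewrite (pihomog_ne0 kd) // scaler0 ifF //; apply/negP => /hL[_ /eqP]; apply/negP.
Qed.

Section Span.
Variable P : T -> Prop.
Hypothesis PS : forall D, P D -> S D.

Lemma spanned_degree L d f a : uniq L ->
    (forall D, D \in L <-> P D /\ mdeg (k D) = d) ->
  spanned P f -> lm f a -> mdeg a = d ->
  exists c : T -> K, lm (\sum_(D <- L) c D *: p D) a.
Proof.
move=> uL hL [r [rP ->]] /initial_monomial_pihomog + ad; rewrite ad.
by rewrite (pihomog_sum PS uL hL rP); exists (total_coef r).
Qed.

Lemma spanned_list L c : (forall D, D \in L -> P D) ->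
  spanned P (\sum_(D <- L) c D *: p D).
Proof.
move=> LP; exists [seq (c D, D) | D <- L]; rewrite big_map; split=> //.
by move=> u /mapP[D /LP PD ->].
Qed.

Section Attained.
Hypothesis P_lm : forall D, P D -> exists f, spanned P f /\ lm f (k D).

(** In the degree of [a], the labels of the family are as many initial monomials
    as there are members, so there is no room for another one. *)
Lemma spanned_initial f a : spanned P f -> lm f a -> exists D, P D /\ k D = a.
Proof.
move=> Pf fa; have [L [uL ukL hL]] := enum_degree (mdeg a) PS.
have [/mapP[D /hL[PD _] ->]|akL] := boolP (a \in map k L); first by exists D.
have : (size (a :: map k L) <= size L)%N.
  apply: initial_monomials_count => [|b]; first by rewrite /= akL.
  case/predU1P=> [->|/mapP[D /hL[PD kD] ->]]; first exact: spanned_degree fa _.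
  by have [g [Pg gD]] := P_lm PD; apply: spanned_degree gD kD.
by rewrite /= size_map ltnn.
Qed.

Lemma spanned_independent : independent P.
Proof.
move=> r rP r0 D; have [PD|nPD] := classic (P D); last first.
  rewrite /total_coef big_seq_cond big1 // => u /andP[/rP Pu /eqP uD].
  by case: nPD; rewrite -uD.
have [L [uL ukL hL]] := enum_degree (mdeg (k D)) PS.
have DL : D \in L by apply/hL.
apply: (free_of_initial_monomials (c := total_coef r) uL ukL) DL.
- by rewrite size_map.
- move=> b /mapP[E /hL[PE kE] ->].
  by have [g [Pg gE]] := P_lm PE; apply: spanned_degree gE kE.
- by rewrite -(pihomog_sum PS uL hL rP) r0 pihomog0.
Qed.

End Attained.

(** The labels in one degree are as many as the members, and by assumption they
    contain all initial monomials of the span. *)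
Lemma independent_attained : independent P ->
  (forall f a, spanned P f -> lm f a -> exists D, P D /\ k D = a) ->
  forall D, P D -> exists f, spanned P f /\ lm f (k D).
Proof.
move=> Pind Plm D PD; have [L [uL ukL hL]] := enum_degree (mdeg (k D)) PS.
have LP E : E \in L -> P E by case/hL.
have kDL : k D \in map k L by apply: map_f; apply/hL.
have [|c c0 E EL|c a lma|c lmc] := initial_monomials_attained uL _ _ _ kDL.
- by rewrite size_map.
- have := Pind [seq (c E, E) | E <- L] _ _ E.
  rewrite total_coef_graph // big_map.
  by apply=> // u /mapP[F /LP PF ->].
- have [E [PE kE]] := Plm _ _ (spanned_list c LP) lma; rewrite -kE.
  apply: map_f; apply/hL; split=> //.
  have sum_homog : \sum_(D <- L) c D *: p D \is (mdeg (k D)).-homog.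
    rewrite big_seq; apply: rpred_sum => F /hL[PF <-].
    by apply: dhomogZ; apply: p_homog; apply: PS.
  by rewrite kE; apply: (dhomog_mf sum_homog (proj1 lma)).
- by exists (\sum_(D <- L) c D *: p D); split=> //; apply: spanned_list.
Qed.
End Span.

Lemma independent_sub (P Q : T -> Prop) : 
  (forall D, Q D -> P D) -> independent P -> independent Q.
Proof. by move=> QP Pind r rQ; apply: Pind => u /rQ /QP. Qed.

(** The two combinations agree coefficient by coefficient, so that only labels
    common to both contribute. *)
Lemma spanned_cap (P P1 P2 : T -> Prop) f : independent P ->
    (forall D, P1 D -> P D) -> (forall D, P2 D -> P D) ->
  spanned P1 f -> spanned P2 f -> spanned (fun D => P1 D /\ P2 D) f.
Proof.
move=> Pind P1P P2P [r1 [r1P f1]] [r2 [r2P f2]].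
have coefE D : total_coef r1 D = total_coef r2 D.
  have := Pind (r1 ++ [seq (- u.1, u.2) | u <- r2]) _ _ D.
  rewrite /total_coef !big_cat !big_map /= -f1.
  under eq_bigr do rewrite scaleNr; rewrite !sumrN -f2 => h.
  apply/eqP; rewrite -subr_eq0 h ?subrr // => u.
  by rewrite mem_cat => /orP[/r1P/P1P|/mapP[v /r2P/P2P ? ->]].
pose L := undup (map snd r1).
have fL : f = \sum_(D <- L) total_coef r1 D *: p D.
  rewrite -sum_total_coef ?undup_uniq // f1 big_seq [RHS]big_seq_cond.
  apply: eq_bigl => u; rewrite andb_idr // => ur.
  by rewrite mem_undup map_f.
have {fL} -> : f = \sum_(D <- [seq D <- L | D \in map snd r2]) total_coef r1 D *: p D.
  rewrite fL big_filter (bigID (fun D => D \in map snd r2)) /= [X in _ + X]big1 ?addr0 //.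
  move=> D Dr2; rewrite coefE /total_coef big_seq_cond big1 ?scale0r //.
  by move=> u /andP[ur /eqP uD]; case/negP: Dr2; rewrite -uD map_f.
apply: spanned_list => D; rewrite mem_filter mem_undup.
by case/andP=> /mapP[v /r2P P2v ->] /mapP[u /r1P P1u vu]; split=> //; rewrite vu.
Qed.

End Family.
End Leading.

(** * Initial ideals *)

Section InitialIdeals.
Variables (K : fieldType) (N : nat) (le : rel 'X_{1..N}).
Hypothesis le_order : term_order le.
Local Notation R := {mpoly K[N]}.
Implicit Types (I J L S : R -> Prop) (f g h : R).

Lemma ideal_scale I c f : is_ideal I -> I f -> I (c *: f).
Proof. by case=> _ _ IM If; rewrite -mul_mpolyC; apply: IM. Qed.

Lemma ideal_sum (T : eqType) I (r : seq T) (F : T -> R) : is_ideal I ->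
  (forall x, x \in r -> I (F x)) -> I (\sum_(x <- r) F x).
Proof. by case=> I0 ID _ hF; rewrite big_seq; apply: (big_ind I). Qed.

Lemma initial_ideal_is_ideal S : is_ideal (initial_ideal le S).
Proof.
split=> [L LI _|f g hf hg L LI SL|f g hg L LI SL]; case: (LI) => L0 LD LM //.
  by apply: LD; [exact: hf | exact: hg].
by apply: LM; exact: hg.
Qed.

Lemma initial_ideal_sub S S' h : (forall f, S f -> S' f) ->
  initial_ideal le S h -> initial_ideal le S' h.
Proof.
move=> SS' hS L LI S'L; apply: hS => // g [f [a [Sf fa ->]]].
by apply: S'L; exists f, a; split=> //; apply: SS'.
Qed.

Lemma initial_ideal_monomial S f a :
  S f -> initial_monomial le f a -> initial_ideal le S 'X_[a].
Proof. by move=> Sf fa L _; apply; exists f, a. Qed.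

(** The initial monomials of an ideal are closed under multiplication by
    monomials, so the polynomials supported on them already form an ideal. *)
Lemma initial_idealP I h : is_ideal I -> initial_ideal le I h <->
  (forall a, a \in msupp h -> exists f, I f /\ initial_monomial le f a).
Proof.
move=> II; split=> [hI|hI]; last first.
  have inI := initial_ideal_is_ideal I.
  rewrite [h]mpolyE; apply: (ideal_sum inI) => a /hI[f [If fa]].
  exact: (ideal_scale _ inI (initial_ideal_monomial If fa)).
apply: (hI (fun h => forall a, a \in msupp h ->
                 exists f, I f /\ initial_monomial le f a)); last first.
  by move=> g [f [a [If fa ->]]] b; rewrite msuppX inE => /eqP->; exists f.
split=> [a|f g hf hg a|f g hg a]; first by rewrite msupp0.
  by move/msuppD_le; rewrite mem_cat => /orP[/hf|/hg].
move/msuppM_le/allpairsP => [[b c] [/= bf cg ->]].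
have [e [Ie [ce emax]]] := hg c cg.
case: II le_order => _ _ IM [_ _ _ _ leD].
exists ('X_[b] * e); split; first exact: IM.
have Xe : 'X_[b] * e = e * 'X_[b] :> R by apply: mulrC.
split; first by rewrite mcoeff_msupp Xe mcoeffMX -mcoeff_msupp.
move=> d /msuppM_le/allpairsP[[b' d'] [/=]].
rewrite msuppX inE => /eqP-> /emax dc ->.
by rewrite ![(b + _)%MM]addmC; apply: leD.
Qed.

Lemma ideal_add_is_ideal I J : is_ideal I -> is_ideal J -> is_ideal (ideal_add I J).
Proof.
move=> [I0 ID IM] [J0 JD JM]; split.
- by exists 0, 0; rewrite addr0.
- move=> _ _ [f [g [If Jg ->]]] [f' [g' [If' Jg' ->]]].
  by exists (f + f'), (g + g'); split; [apply: ID | apply: JD | rewrite addrACA].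
- move=> e _ [f [g [If Jg ->]]].
  by exists (e * f), (e * g); split; [apply: IM | apply: JM | rewrite mulrDr].
Qed.

Lemma ideal_cap_is_ideal I J : is_ideal I -> is_ideal J -> is_ideal (ideal_cap I J).
Proof.
move=> [I0 ID IM] [J0 JD JM]; split=> //.
  by move=> f g [? ?] [? ?]; split; [apply: ID | apply: JD].
by move=> f g [? ?]; split; [apply: IM | apply: JM].
Qed.

Lemma ideal_addl I J f : is_ideal J -> I f -> ideal_add I J f.
Proof. by case=> J0 _ _ If; exists f, 0; rewrite addr0. Qed.

Lemma ideal_addr I J f : is_ideal I -> J f -> ideal_add I J f.
Proof. by case=> I0 _ _ Jf; exists 0, f; rewrite add0r. Qed.

End InitialIdeals.

(** * Sums and intersections of in-KRS ideals *)

Section KRSIdeals.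
Variables (K : fieldType) (m n : nat) (le : rel 'X_{1..m * n}).
Hypothesis le_order : term_order le.
Local Notation R := {mpoly K[m * n]}.
Local Notation lm := (initial_monomial le).
Local Notation bitableau := (bitableau m n).
Local Notation poly := (@bitableau_poly K m n).
Local Notation spanned := (spanned poly).
Implicit Types (I J L : R -> Prop) (f g h : R) (P : bitableau -> Prop) (D : bitableau).

Lemma dhomog_prod_seq (T : Type) (r : seq T) (F : T -> R) (d : T -> nat) :
  (forall x, F x \is (d x).-homog) ->
  \prod_(x <- r) F x \is (\sum_(x <- r) d x)%N.-homog.
Proof.
move=> hF; elim: r => [|x r IH]; first by rewrite !big_nil dhomog1.
by rewrite !big_cons; apply: dhomogM.
Qed.

Lemma minor_poly_homog (d : minor m n) : minor_poly K d \is (size d).-homog.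
Proof.
rewrite /minor_poly /determinant; apply: rpred_sum => s _; rewrite rpredMsign.
have sz : (\sum_(i < size d) 1)%N = size d by rewrite sum1_card card_ord.
move: dhomog_prod_seq => /(_ _ (index_enum 'I_(size d)) _ (fun=> 1%N)).
rewrite sz; apply=> i; by rewrite mxE dhomogX; apply/eqP/mdeg1.
Qed.

Lemma bitableau_poly_homog D : standard D -> poly D \is (mdeg (krs D)).-homog.
Proof.
move/mdeg_krs => ->; rewrite /boxes sumnE big_map.
exact/dhomog_prod_seq/minor_poly_homog.
Qed.

Definition standard_in I D : Prop := standard D /\ I (poly D).

Lemma spanned_sub P Q f : (forall D, P D -> Q D) -> spanned P f -> spanned Q f.
Proof. by move=> PQ [r [rP fr]]; exists r; split=> // u /rP/PQ. Qed.

Lemma spanned_add P f g : spanned P f -> spanned P g -> spanned P (f + g).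
Proof.
move=> [r1 [r1P ->]] [r2 [r2P ->]]; exists (r1 ++ r2); rewrite big_cat; split=> // u.
by rewrite mem_cat => /orP[/r1P|/r2P].
Qed.

Lemma ideal_spanned I P f : is_ideal I -> (forall D, P D -> I (poly D)) ->
  spanned P f -> I f.
Proof.
move=> II PI [r [rP ->]]; apply: (ideal_sum II) => u /rP/PI Iu.
exact: (ideal_scale _ II).
Qed.

Lemma KRS_image_standard I D : standard D -> I (poly D) ->
  KRS_image I ('X_[krs D] : R).
Proof.
move=> Dst ID; exists (poly D); split=> //; exists [:: (1, D)].
by rewrite !big_seq1 !scale1r; split=> // u; rewrite inE => /eqP->.
Qed.

Lemma in_KRS_initial I D : in_KRS le I -> standard_in I D ->
  exists f, spanned (standard_in I) f /\ lm f (krs D).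
Proof.
move=> [II Ib Ik] [Dst ID]; have := KRS_image_standard Dst ID.
move=> /Ik/(initial_idealP le_order _ II)/(_ (krs D)) [|f [/Ib If fD]].
  by rewrite msuppX mem_head.
by exists f.
Qed.

Lemma in_KRS_zero I g : in_KRS le I -> KRS_image (eq^~ 0) g -> initial_ideal le I g.
Proof. by move=> [[I0 _ _] _ Ik] [f [-> fg]]; apply/Ik; exists 0. Qed.

(** A value of KRS at an element of [L] may come from any expression by standard
    bitableaux. Subtracting the value for an expression by members of [P] leaves
    a value of KRS at 0, which the last hypothesis controls. *)
Lemma in_KRS_criterion P L : is_ideal L -> (forall D, P D -> standard D) ->
    (forall f, L f <-> spanned P f) ->
    (forall a, (exists f, L f /\ lm f a) <-> exists D, P D /\ krs D = a) ->
    (forall g, KRS_image (eq^~ 0) g -> initial_ideal le L g) ->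
  in_KRS le L.
Proof.
move=> LI PS LP Llm L0.
have PL D : P D -> L (poly D).
  move=> PD; apply/LP; exists [:: (1, D)]; rewrite big_seq1 scale1r.
  by split=> // u; rewrite inE => /eqP->.
split=> // [f|g].
  rewrite -/(spanned (standard_in L) f); split=> [/LP|].
    by apply: spanned_sub => D PD; split; [apply: PS | apply: PL].
  by apply: (ideal_spanned LI) => D [].
split=> [/(initial_idealP le_order _ LI) gL|].
  rewrite [g]mpolyE big_seq; apply: big_ind.
  - by exists 0; split; [case: LI | exists [::]; rewrite !big_nil].
  - move=> g1 g2 [f1 [Lf1 [r1 [r1S e1 e1']]]] [f2 [Lf2 [r2 [r2S e2 e2']]]].
    exists (f1 + f2); split; first by case: LI => _ LD _; apply: LD.
    exists (r1 ++ r2); rewrite !big_cat e1 e1' e2 e2'; split=> // u.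
    by rewrite mem_cat => /orP[/r1S|/r2S].
  move=> a /gL/Llm[D [PD <-]]; exists (g@_(krs D) *: poly D); split.
    exact: (ideal_scale _ LI (PL _ PD)).
  exists [:: (g@_(krs D), D)]; rewrite !big_seq1; split=> // u.
  by rewrite inE => /eqP->; apply: PS.
case=> f [Lf [r [rS fr ->]]]; have [r1 [r1P fr1]] := (LP f).1 Lf.
have inL := initial_ideal_is_ideal le L; have [_ inD _] := inL.
rewrite -[X in initial_ideal _ _ X](subrK (\sum_(u <- r1) u.1 *: 'X_[krs u.2])).
apply: inD.
  apply: L0; exists 0; split=> //.
  exists (r ++ [seq (- u.1, u.2) | u <- r1]); rewrite !big_cat !big_map /=.
  split=> [u||].
  - rewrite mem_cat => /orP[/rS//|/mapP[v /r1P/PS ? ->]] //.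
  - rewrite -fr; under eq_bigr do rewrite scaleNr.
    by rewrite sumrN -fr1 subrr.
  - by congr (_ + _); rewrite -sumrN; apply: eq_bigr => u _; rewrite scaleNr.
apply: (ideal_sum inL) => u /r1P Pu; apply: (ideal_scale _ inL).
have [|f' [Lf' fa]] := (Llm (krs u.2)).2; first by exists u.2.
exact: initial_ideal_monomial Lf' fa.
Qed.

Lemma initial_monomial_standard L f a : in_KRS le L -> L f -> lm f a ->
  exists D, standard_in L D /\ krs D = a.
Proof.
move=> L_krs Lf; have LS D : standard_in L D -> standard D by case.
apply: (spanned_initial le_order (@krs_inj m n) bitableau_poly_homog LS).
  by move=> D; apply: in_KRS_initial.
by case: L_krs => _ Lb _; apply/Lb.
Qed.

Section TwoIdeals.
Variables I J : R -> Prop.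
Hypotheses (I_krs : in_KRS le I) (J_krs : in_KRS le J).

Let II : is_ideal I. Proof. by case: I_krs. Qed.
Let JI : is_ideal J. Proof. by case: J_krs. Qed.
Let IA f : I f <-> spanned (standard_in I) f. Proof. by case: I_krs. Qed.
Let JB f : J f <-> spanned (standard_in J) f. Proof. by case: J_krs. Qed.

Let AB D : Prop := standard_in I D \/ standard_in J D.
Let AB_standard D : AB D -> standard D. Proof. by case=> -[]. Qed.

Let AB_initial D : AB D -> exists f, spanned AB f /\ lm f (krs D).
Proof.
case=> [/(in_KRS_initial I_krs)|/(in_KRS_initial J_krs)] [f [hf fD]];
by exists f; split=> //; apply: spanned_sub hf => E; by [left | right].
Qed.

Let AB_independent : independent poly AB.
Proof.
exact: (spanned_independent le_order (@krs_inj m n) bitableau_poly_homog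
          AB_standard AB_initial).
Qed.

Lemma ideal_add_spanned f : ideal_add I J f <-> spanned AB f.
Proof.
split=> [[f1 [f2 [/IA h1 /JB h2 ->]]]|].
  by apply: spanned_add; [apply: spanned_sub h1|apply: spanned_sub h2];
    move=> D ?; [left | right].
apply: (ideal_spanned (ideal_add_is_ideal II JI)).
by move=> D [[_ h]|[_ h]]; [apply: ideal_addl|apply: ideal_addr].
Qed.

Lemma ideal_add_initial a :
  (exists f, ideal_add I J f /\ lm f a) <-> exists D, AB D /\ krs D = a.
Proof.
split=> [[f [/ideal_add_spanned ABf]]|[D [/AB_initial[f [ABf fD]] <-]]].
  exact: (spanned_initial le_order (@krs_inj m n) bitableau_poly_homog
            AB_standard AB_initial).
by exists f; split=> //; apply/ideal_add_spanned.
Qed.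

Lemma in_KRS_add : in_KRS le (ideal_add I J).
Proof.
apply: (in_KRS_criterion _ AB_standard ideal_add_spanned ideal_add_initial).
  exact: ideal_add_is_ideal.
move=> g /(in_KRS_zero I_krs); apply: initial_ideal_sub => f.
exact: ideal_addl.
Qed.

Let A_B D : Prop := standard_in I D /\ standard_in J D.
Let A_B_standard D : A_B D -> standard D. Proof. by case=> -[]. Qed.

Lemma ideal_cap_spanned f : ideal_cap I J f <-> spanned A_B f.
Proof.
split=> [[/IA If /JB Jf]|ABf].
  by apply: (spanned_cap AB_independent) If Jf => D; [left | right].
by split; [apply: (ideal_spanned II) ABf | apply: (ideal_spanned JI) ABf];
  move=> D [[_ ?] [_ ?]].
Qed.

Lemma initial_monomial_cap f g a : I f -> lm f a -> J g -> lm g a ->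
  exists D, A_B D /\ krs D = a.
Proof.
move=> If fa Jg ga; have [D [ID Da]] := initial_monomial_standard I_krs If fa.
have [E [JE Ea]] := initial_monomial_standard J_krs Jg ga.
exists D; split=> //; split=> //; have -> // : D = E.
by apply: krs_inj; [case: ID | case: JE | rewrite Da].
Qed.

Lemma ideal_cap_initial a :
  (exists f, ideal_cap I J f /\ lm f a) <-> exists D, A_B D /\ krs D = a.
Proof.
split=> [[f [[If Jf] fa]]|[D [hD <-]]]; first exact: (initial_monomial_cap If fa Jf).
have A_B_independent : independent poly A_B.
  by apply: independent_sub AB_independent => E [? _]; left.
have [] // := independent_attained le_order (@krs_inj m n) bitableau_poly_homog
  A_B_standard A_B_independent _ hD.
  by move=> f b /ideal_cap_spanned[If Jf] fb; apply: (initial_monomial_cap If fb Jf).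
by move=> f [/ideal_cap_spanned ? ?]; exists f.
Qed.

Lemma in_KRS_cap : in_KRS le (ideal_cap I J).
Proof.
have LI := ideal_cap_is_ideal II JI.
apply: (in_KRS_criterion LI A_B_standard ideal_cap_spanned ideal_cap_initial) => g g0.
apply/(initial_idealP le_order _ LI) => a ag; apply/ideal_cap_initial.
have [f [If fa]] := (initial_idealP le_order _ II).1 (in_KRS_zero I_krs g0) a ag.
have [h [Jh ha]] := (initial_idealP le_order _ JI).1 (in_KRS_zero J_krs g0) a ag.
exact: initial_monomial_cap If fa Jh ha.
Qed.

End TwoIdeals.

(** Each initial monomial of the sum is one of [I] or of [J], and so a member of
    the ideal generated by the initial monomials of the bitableaux there. *)
Lemma G_KRS_add I J : G_KRS le I -> G_KRS le J -> G_KRS le (ideal_add I J).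
Proof.
move=> [I_krs [_ IG]] [J_krs [_ JG]].
have II : is_ideal I by case: I_krs.
have JI : is_ideal J by case: J_krs.
split; first exact: in_KRS_add.
split=> [g [] //|h]; split; first by apply: initial_ideal_sub => g [].
move/(initial_idealP le_order _ (ideal_add_is_ideal II JI)) => hlm.
set G := (fun g => ideal_add I J g /\ _).
have inG := initial_ideal_is_ideal le G.
rewrite [h]mpolyE; apply: (ideal_sum inG) => a /hlm ha; apply: (ideal_scale _ inG).
have [D [+ <-]] := (ideal_add_initial I_krs J_krs a).1 ha.
case=> [hD|hD].
  have [f [If fD]] := in_KRS_initial I_krs hD.
  have If' : I f by case: I_krs => _ Ib _; apply/Ib.
  have /IG := initial_ideal_monomial If' fD.
  apply: initial_ideal_sub => g [Ig gD]; split=> //; exact: ideal_addl.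
have [f [Jf fD]] := in_KRS_initial J_krs hD.
have Jf' : J f by case: J_krs => _ Jb _; apply/Jb.
have /JG := initial_ideal_monomial Jf' fD.
apply: initial_ideal_sub => g [Jg gD]; split=> //; exact: ideal_addr.
Qed.

End KRSIdeals.

Local Close Scope ring_scope.

Theorem lemma4p5 (K : fieldType) (m n : nat) (le : rel 'X_{1..m * n})
    (le_diag : diagonal_term_order K le)
    (I J : {mpoly K[m * n]} -> Prop)
    (I_ideal : is_ideal I) (J_ideal : is_ideal J)
    (I_basis : has_standard_basis I) (J_basis : has_standard_basis J) :
  (G_KRS le I -> G_KRS le J -> G_KRS le (ideal_add I J))
  /\ (in_KRS le I -> in_KRS le J ->
      in_KRS le (ideal_add I J) /\ in_KRS le (ideal_cap I J)).
Proof.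
case: le_diag => le_order _; split; first exact: G_KRS_add.
by move=> I_krs J_krs; split; [apply: in_KRS_add | apply: in_KRS_cap].
Qed.
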